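(* Let $a<b$ and $N\ge1$ be integers, $\mathbf{I}=\{a,\dots,b\}$, $\mathbf{J}=\{0,\dots,N\}$, $\mathbf{I}^*=\{a+\tfrac12,\dots,b-\tfrac12\}$, $\mathbf{J}^*=\{\tfrac12,\dots,N-\tfrac12\}$, and $\beta>0$. Let the fermion operators be defined on horizontal edges $k+iy\in\mathbf{I}^*\times\mathbf{J}$ by $\psi(k+iy)=V^{-y}\psi_kV^y$ and $\bar\psi(k+iy)=V^{-y}\bar\psi_kV^y$. Then there exists a unique extension of $\psi$ and $\bar\psi$ (as operator-valued functions) to the set of vertical edges $\mathbf{I}\times\mathbf{J}^*$ such that the following local relations hold. For any face of $\mathbf{I}\times\mathbf{J}$, with center $c$ and edges $E=c+\frac12$, $N=c+\frac i2$, $W=c-\frac12$, $S=c-\frac i2$, $$\psi(N)+\nu^{-1}\lambda\bar\psi(N)=\nu^{-1}\psi(E)+\lambda\bar\psi(E),$$ $$\psi(N)+\nu\lambda^{-1}\bar\psi(N)=\nu\psi(W)+\lambda^{-1}\bar\psi(W),$$ $$\psi(S)+\nu\lambda^{3}\bar\psi(S)=\nu\psi(E)+\lambda^{3}\bar\psi(E),$$ $$\psi(S)+\nu^{-1}\lambda^{-3}\bar\psi(S)=\nu^{-1}\psi(W)+\lambda^{-3}\bar\psi(W),$$ and on the left and right boundaries, for any $y\in\mathbf{J}^*$, $$\psi(a+iy)+i\,\bar\psi(a+iy)=0,\qquad \psi(b+iy)-i\,\bar\psi(b+iy)=0.$$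
   Context: Edges are identified with their midpoints in $\mathbb{C}$, and $\mathbf{I}^*\times\mathbf{J}$ etc. with subsets of $\mathbb{C}$ via $(x,y)\mapsto x+iy$; faces are identified with their centers, the points of $\mathbf{I}^*\times\mathbf{J}^*$. $\lambda=e^{i\pi/4}$, $\nu=\lambda^{-3}\frac{e^{-2\beta}+i}{e^{-2\beta}-i}$ (so $\nu=1$ at $\beta_c=\frac12\ln(\sqrt2+1)$). $\mathcal{S}$ is the complex vector space with basis $(\mathbf{e}_\sigma)_{\sigma\in\{\pm1\}^{\mathbf{I}}}$. The transfer matrix is $V=(V^{h})^{1/2}V^{v}(V^{h})^{1/2}$, where $V^v_{\sigma\rho}=\exp(\beta\sum_{i=a}^b\sigma_i\rho_i)$ if $\sigma_a=\rho_a$ and $\sigma_b=\rho_b$, and $0$ otherwise; $(V^h)^{1/2}$ is diagonal with entries $\exp(\frac{\beta}{2}\sum_{i=a}^{b-1}\sigma_i\sigma_{i+1})$. For $k\in\mathbf{I}^*$: $p_k(\mathbf{e}_\sigma)=\sigma_{k+1/2}\mathbf{e}_\tau$, $q_k(\mathbf{e}_\sigma)=i\,\sigma_{k-1/2}\mathbf{e}_\tau$, where $\tau_x=\sigma_x$ for $x>k$ and $\tau_x=-\sigma_x$ for $x<k$; $\psi_k=\frac{i}{\sqrt2}(p_k+q_k)$ and $\bar\psi_k=\frac{1}{\sqrt2}(p_k-q_k)$, operators $\mathcal{S}\to\mathcal{S}$. *)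

(* Defs.v *)
From mathcomp Require Export all_boot all_order all_algebra.
From mathcomp Require Export complex.
From mathcomp Require Export boolp classical_sets reals sequences exp trigo.

Set Implicit Arguments.
Unset Strict Implicit.
Unset Printing Implicit Defensive.

Export Order.TTheory GRing.Theory Num.Theory.

Global Open Scope classical_set_scope.
Global Open Scope ring_scope.
Global Open Scope complex_scope.

Definition lambda (R : realType) : R[i] := cos (pi / 4%:R) +i* sin (pi / 4%:R).

Definition nu (R : realType) (beta : R) : R[i] :=
  lambda R ^- 3 *
  (((expR (- (2%:R * beta)))%:C + 'i) / ((expR (- (2%:R * beta)))%:C - 'i)).

Definition int_seg (R : realType) (p q : int) : set R :=
  [set x%:~R | x in [set x : int | p <= x <= q]].

(* For I = int_seg a b and J = int_seg 0 N these are the dual intervals I^* and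
   J^*. *)
Definition half_seg (R : realType) (p q : int) : set R :=
  [set x%:~R + 2%:R^-1 | x in [set x : int | p <= x < q]].

Definition box (R : realType) (X Y : set R) : set R[i] :=
  [set x +i* y | x in X & y in Y].

Definition vertical_edges (R : realType) (a b : int) (N : nat) : set R[i] :=
  box (@int_seg R a b) (@half_seg R 0 N%:Z).

Definition face_centers (R : realType) (a b : int) (N : nat) : set R[i] :=
  box (@half_seg R a b) (@half_seg R 0 N%:Z).

(* Configurations {+1,-1}^I with I = {a, ..., b}, for a <= b: the index i stands
   for the site a + i, and the booleans false, true for the spins +1, -1. *)
Definition config (a b : int) : finType := {ffun 'I_(`|b - a|%N).+1 -> bool}.

(* sigma_x; only meaningful for a <= x <= b. *)
Definition spin (R : realType) (a b : int) (sigma : config a b) (x : int) : R :=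
  (-1) ^+ sigma (inord `|x - a|%N).

(* The state space is the space of column vectors over the configurations, and
   operators act on it by left multiplication. *)
Definition state (R : realType) (a b : int) := 'cV[R[i]]_#|config a b|.
Definition op (R : realType) (a b : int) := 'M[R[i]]_#|config a b|.

Definition e_ (R : realType) (a b : int) (sigma : config a b) : state R a b :=
  delta_mx (enum_rank sigma) 0.

Definition op_entries (R : realType) (a b : int)
    (f : config a b -> config a b -> R) : op R a b :=
  \matrix_(i, j) (f (enum_val i) (enum_val j))%:C.

(* The operator sending each basis vector e_ sigma to f sigma. *)
Definition op_basis (R : realType) (a b : int)
    (f : config a b -> state R a b) : op R a b :=
  \matrix_(i, j) f (enum_val j) i 0.

Definition Vv (R : realType) (a b : int) (beta : R) : op R a b :=
  op_entries (fun sigma rho =>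
    if (spin R sigma a == spin R rho a) && (spin R sigma b == spin R rho b)
    then expR (beta * \sum_(i < (`|b - a|%N).+1)
                        spin R sigma (a + i%:Z) * spin R rho (a + i%:Z))
    else 0).

Definition Vh_half (R : realType) (a b : int) (beta : R) : op R a b :=
  op_entries (fun sigma rho =>
    if sigma == rho
    then expR (beta / 2%:R * \sum_(i < `|b - a|%N)
                 spin R sigma (a + i%:Z) * spin R sigma (a + i%:Z + 1))
    else 0).

Definition V (R : realType) (a b : int) (beta : R) : op R a b :=
  Vh_half a b beta *m Vv a b beta *m Vh_half a b beta.

(* In the next five definitions the half-integer k is given by the integer
   x = k - 1/2, so that the sites to the left of k are those at most x. *)
Definition flip_left (a b : int) (x : int) (sigma : config a b) : config a b :=
  [ffun i : 'I_(`|b - a|%N).+1 => sigma i (+) (a + (i : nat)%:Z <= x)].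

Definition p_ (R : realType) (a b : int) (x : int) : op R a b :=
  op_basis (fun sigma => (spin R sigma (x + 1))%:C *: e_ R (flip_left x sigma)).

Definition q_ (R : realType) (a b : int) (x : int) : op R a b :=
  op_basis (fun sigma => ('i * (spin R sigma x)%:C) *: e_ R (flip_left x sigma)).

Definition psi_ (R : realType) (a b : int) (x : int) : op R a b :=
  ('i / (Num.sqrt 2%:R)%:C) *: (p_ R a b x + q_ R a b x).

Definition psibar_ (R : realType) (a b : int) (x : int) : op R a b :=
  (1 / (Num.sqrt 2%:R)%:C) *: (p_ R a b x - q_ R a b x).

(* V^{-y} A V^y *)
Definition evolve (R : realType) (a b : int) (beta : R) (y : nat)
    (A : op R a b) : op R a b :=
  invmx (V a b beta) ^+ y *m A *m V a b beta ^+ y.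

(* Functions on edges are total functions on the plane R[i], of which only the
   values at edge midpoints are ever used. *)
Definition extends_horizontal (R : realType) (a b : int) (N : nat) (beta : R)
    (psi psibar : R[i] -> op R a b) : Prop :=
  forall (x : int) (y : nat), a <= x < b -> (y <= N)%N ->
    let edge := (x%:~R + 2%:R^-1) +i* y%:R in
    psi edge = evolve beta y (psi_ R a b x) /\
    psibar edge = evolve beta y (psibar_ R a b x).

Definition face_relations (R : realType) (a b : int) (beta : R)
    (psi psibar : R[i] -> op R a b) (c : R[i]) : Prop :=
  let l := lambda R in
  let v := nu beta in
  let east := c + 2%:R^-1 in
  let north := c + 'i / 2%:R in
  let west := c - 2%:R^-1 in
  let south := c - 'i / 2%:R in
  [/\ psi north + (v^-1 * l) *: psibar north
        = v^-1 *: psi east + l *: psibar east,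
      psi north + (v * l^-1) *: psibar north
        = v *: psi west + l^-1 *: psibar west,
      psi south + (v * l ^+ 3) *: psibar south
        = v *: psi east + l ^+ 3 *: psibar east
    & psi south + (v^-1 * l ^- 3) *: psibar south
        = v^-1 *: psi west + l ^- 3 *: psibar west].

Definition boundary_relations (R : realType) (a b : int) (N : nat)
    (psi psibar : R[i] -> op R a b) : Prop :=
  forall y : R, half_seg 0 N%:Z y ->
    psi (a%:~R +i* y) + 'i *: psibar (a%:~R +i* y) = 0 /\
    psi (b%:~R +i* y) - 'i *: psibar (b%:~R +i* y) = 0.

Definition fermion_extension (R : realType) (a b : int) (N : nat) (beta : R)
    (psi psibar : R[i] -> op R a b) : Prop :=
  [/\ extends_horizontal N beta psi psibar,
      forall c, face_centers a b N c -> face_relations beta psi psibar c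
    & boundary_relations N psi psibar].

(* Main.v *)
Require Import Defs.
From mathcomp Require Import ring lra zify.

(* Write P_k and Q_k for the conjugates of p_k and q_k by (V^h)^{1/2}. Conjugation
   by (V^h)^{1/2} mixes p_k with q_k, and conjugation by V^v mixes p_k with q_{k+1}.
   On the face above k, the combinations of psi and psibar at N and S in the two
   relations through E are multiples of the (V^h)^{1/2}-conjugates of
   (V^v)^{-1} p_k V^v and p_k, so they lie in the span of P_k and Q_{k+1}; those
   through W lie in the span of P_{k-1} and Q_k. Hence the fermions on the vertical
   edge j are explicit combinations of P_{j-1/2} and Q_{j+1/2}, and the two faces
   meeting at an inner edge agree. At the ends V^v fixes q_{a+1/2} and p_{b-1/2};
   this is the bulk formula again once one introduces ghost operators p_{a-1/2}
   and q_{b+1/2}, suitable multiples of q_{a+1/2} and p_{b-1/2}, and these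
   multiples are exactly what the boundary relations require. Uniqueness holds
   because the two relations through E (or W) form an invertible 2x2 system. *)

Set Implicit Arguments.
Unset Strict Implicit.
Unset Printing Implicit Defensive.

(** * The factors of the transfer matrix *)

Lemma lambda_sq (R : realType) : lambda R ^+ 2 = 'i.
Proof.
have e : pi / 4%:R *+ 2 = pi / 2%:R :> R by field.
rewrite /lambda expr2; apply/eqP; rewrite eq_complex /=; apply/andP; split; apply/eqP.
  by have := @cosD R (pi / 4%:R) (pi / 4%:R); rewrite -mulr2n e cos_pihalf => <-.
by have := @sinD R (pi / 4%:R) (pi / 4%:R); rewrite -mulr2n e sin_pihalf => H; rewrite [RHS]H; ring.
Qed.

(** A tensor product over the sites of 2x2 matrices; V^v has this form, so it can be inverted site
    by site. *)
Definition kernel_mx (R : realType) (a b : int)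
    (w : 'I_(`|b - a|%N).+1 -> bool -> bool -> R) : op R a b :=
  op_entries (fun sigma rho => \prod_i w i (sigma i) (rho i)).

Lemma sum_config (R : realType) (a b : int) (F : config a b -> R[i]) :
  \sum_(k < #|config a b|) F (enum_val k) = \sum_s F s.
Proof. by rewrite [RHS](big_enum_val F). Qed.

Lemma op_entriesM (R : realType) (a b : int) (f g : config a b -> config a b -> R) :
  op_entries f *m op_entries g
  = op_entries (fun sigma tau => \sum_rho f sigma rho * g rho tau).
Proof.
apply/matrixP => i j; rewrite !mxE.
rewrite rmorph_sum -sum_config; apply: eq_bigr => k _.
by rewrite !mxE rmorphM.
Qed.

Lemma op_entries1 (R : realType) (a b : int) :
  op_entries (fun sigma tau : config a b => (sigma == tau)%:R : R) = 1%:M.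
Proof.
by apply/matrixP => i j; rewrite !mxE (inj_eq enum_val_inj) rmorph_nat.
Qed.

Lemma kernel_mxM (R : realType) (a b : int)
    (w w' : 'I_(`|b - a|%N).+1 -> bool -> bool -> R) :
  (forall i x y, \sum_z w i x z * w' i z y = (x == y)%:R) ->
  kernel_mx w *m kernel_mx w' = 1%:M.
Proof.
move=> ww'; rewrite op_entriesM -op_entries1; congr op_entries.
apply/funext => s; apply/funext => t.
under eq_bigr => r _ do rewrite -big_split /=.
(* Distributivity turns the sum over configurations of a product over sites into a product of
   one-site sums. *)
rewrite -(bigA_distr_bigA (fun i z => w i (s i) z * w' i z (t i))) /=.
under eq_bigr => i _ do rewrite ww'.
have [->|/eqP st] := eqVneq s t; first by rewrite big1 // => i _; rewrite eqxx.
have /existsP[i nei] : [exists i, s i != t i].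
  rewrite -negb_forall; apply/forallP => st'; apply: st; apply/ffunP => i.
  exact/eqP.
by rewrite (bigD1 i) //= (negbTE nei) mul0r.
Qed.

Lemma Vh_halfD (R : realType) (a b : int) (beta beta' : R) :
  Vh_half a b beta *m Vh_half a b beta' = Vh_half a b (beta + beta').
Proof.
rewrite op_entriesM; congr op_entries; apply/funext => s; apply/funext => t.
rewrite (bigD1 s) //= eqxx [X in _ + X]big1 => [|r]; last first.
  by rewrite eq_sym => /negbTE->; rewrite mul0r.
by rewrite addr0; case: eqP => [->|_]; rewrite ?mulr0 // -expRD -!mulrDl.
Qed.

Lemma Vh_half_unit (R : realType) (a b : int) (beta : R) :
  Vh_half a b beta \in unitmx.
Proof.
suff /mulmx1_unit[] : Vh_half a b beta *m Vh_half a b (- beta) = 1%:M by [].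
rewrite Vh_halfD subrr -op_entries1; congr op_entries.
apply/funext => s; apply/funext => t.
by case: eqP => [->|//]; rewrite mul0r mul0r expR0.
Qed.

(** The requirement that the end spins agree is local: it makes the factors at the two end sites
    diagonal. *)
Definition Vv_weight (R : realType) (m : nat) (beta : R) (i : 'I_m.+1) (x y : bool) : R :=
  if (i \in [:: ord0; ord_max]) && (x != y) then 0
  else expR (beta * ((-1) ^+ x * (-1) ^+ y)).

Lemma spinE (R : realType) (a b : int) (s : config a b) (i : 'I_(`|b - a|%N).+1) :
  spin R s (a + i%:Z) = (-1) ^+ s i.
Proof.
rewrite /spin (_ : `|(a + i%:Z) - a : int|%N = i) ?inord_val //.
by rewrite [a + _]addrC addrK absz_nat.
Qed.

Lemma spinaE (R : realType) (a b : int) (s : config a b) :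
  spin R s a = (-1) ^+ s ord0.
Proof. by rewrite -(spinE R s ord0) addr0. Qed.

Lemma spinbE (R : realType) (a b : int) (s : config a b) : a < b ->
  spin R s b = (-1) ^+ s ord_max.
Proof.
move=> ab; rewrite -(spinE R s ord_max) /=; congr spin; lia.
Qed.

Lemma sign_eq (R : realType) (x y : bool) : ((-1) ^+ x == (-1) ^+ y :> R) = (x == y).
Proof. by rewrite (inj_eq (@signr_inj R)). Qed.

Lemma Vv_kernel (R : realType) (a b : int) (beta : R) : a < b ->
  Vv a b beta = kernel_mx (Vv_weight beta).
Proof.
move=> ab; congr op_entries; apply/funext => s; apply/funext => t.
rewrite !spinaE !spinbE // !sign_eq.
case: ifPn => [/andP[/eqP s0 /eqP sm]|/nandP ne].
  rewrite mulr_sumr expR_sum; apply: eq_bigr => i _.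
  rewrite !spinE /Vv_weight !inE; case: eqP => [->|_]; first by rewrite s0 eqxx.
  by case: eqP => [->|_] //=; rewrite sm eqxx.
by apply/esym/eqP/prodf_eq0; case: ne => ne; [exists ord0 | exists ord_max] => //;
  rewrite /Vv_weight !inE eqxx ?orbT ne.
Qed.

Lemma Vv_unit (R : realType) (a b : int) (beta : R) : a < b -> 0 < beta ->
  Vv a b beta \in unitmx.
Proof.
move=> ab beta0; rewrite Vv_kernel //.
(* The sitewise inverse: at the end sites the factor is e^beta times the identity; elsewhere [w'] is
   the adjugate over the determinant e^(2 beta) - e^(-2 beta), nonzero since [beta] is positive. *)
pose w' (i : 'I_(`|b - a|%N).+1) (x y : bool) : R :=
  if i \in [:: ord0; ord_max] then (x == y)%:R * expR (- beta)
  else (-1) ^+ (x (+) y) * expR (beta * ((-1) ^+ x * (-1) ^+ y))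
         / (expR beta ^+ 2 - expR (- beta) ^+ 2).
suff /(@kernel_mxM R a b)/mulmx1_unit[] :
  forall i x y, \sum_z Vv_weight beta i x z * w' i z y = (x == y)%:R by [].
have h0 : expR beta != 0 by rewrite gt_eqF ?expR_gt0.
have h1 : 1 < expR beta by rewrite expR_gt1.
have h4 : expR beta ^+ 4 - 1 != 0 by rewrite subr_eq0 gt_eqF ?exprn_egt1.
move=> i x y; rewrite big_bool /Vv_weight /w'; case: (i \in _) => /=.
  by case: x; case: y;
    rewrite /= ?expr1 !(mulrNN, mulr1, mul0r, mul1r, mulr0, add0r, addr0) // -expRD
      ?subrr ?addrN expR0.
case: x; case: y;
  rewrite /= ?expr1 ?expr0 !(mulrNN, mulrN, mulNr, mulr1, mul1r) !expRN;
  field; rewrite ?h0 -expr2 -exprM //.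
Qed.

(** * Conjugation of the Clifford generators *)

(* With h = exp beta: cosh beta, sinh beta, coth (2 beta) and 1 / sinh (2 beta). *)
Definition cosh_of (K : fieldType) (h : K) := (h + h^-1) / 2%:R.
Definition sinh_of (K : fieldType) (h : K) := (h - h^-1) / 2%:R.
Definition coth2_of (K : fieldType) (h : K) := (h ^+ 2 + h ^- 2) / (h ^+ 2 - h ^- 2).
Definition csch2_of (K : fieldType) (h : K) := 2%:R / (h ^+ 2 - h ^- 2).

Lemma flip_leftK (a b x : int) : involutive (@flip_left a b x).
Proof. by move=> s; apply/ffunP => i; rewrite !ffunE addbK. Qed.

Lemma spin_flip (R : realType) (a b x y : int) (s : config a b) : a <= y <= b ->
  spin R (flip_left x s) y = (if y <= x then -1 else 1) * spin R s y.
Proof.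
move=> yab; rewrite /spin ffunE inordK; last by lia.
rewrite (_ : a + `|y - a|%N%:Z = y); last by lia.
by case: (y <= x); case: (s _); rewrite /= ?expr0 ?expr1 ?mulrNN ?mul1r ?mulr1.
Qed.

Lemma mulmx_basis (R : realType) (a b : int) (A : op R a b)
    (g : config a b -> R[i]) (f : config a b -> config a b) i j :
  (A *m op_basis (fun s => g s *: e_ R (f s))) i j
  = g (enum_val j) * A i (enum_rank (f (enum_val j))).
Proof.
rewrite !mxE (bigD1 (enum_rank (f (enum_val j)))) //= !mxE !eqxx mulr1 mulrC.
rewrite big1 ?addr0 // => k /negbTE nk; by rewrite !mxE nk mulr0 mulr0.
Qed.

Lemma basis_mulmx (R : realType) (a b : int) (A : op R a b)
    (g : config a b -> R[i]) (f : config a b -> config a b) (fK : involutive f) i j :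
  (op_basis (fun s => g s *: e_ R (f s)) *m A) i j
  = g (f (enum_val i)) * A (enum_rank (f (enum_val i))) j.
Proof.
rewrite !mxE (bigD1 (enum_rank (f (enum_val i)))) //= !mxE.
rewrite !enum_rankK fK enum_valK !eqxx mulr1.
rewrite big1 ?addr0 // => k nk; rewrite !mxE.
have [ik|] := eqVneq i; last by rewrite mulr0 mul0r.
by case/eqP: nk; rewrite ik enum_rankK fK enum_valK.
Qed.

Lemma mulmx_p (R : realType) (a b x : int) (A : op R a b) i j :
  (A *m p_ R a b x) i j
  = (spin R (enum_val j) (x + 1))%:C * A i (enum_rank (flip_left x (enum_val j))).
Proof. exact: mulmx_basis. Qed.

Lemma mulmx_q (R : realType) (a b x : int) (A : op R a b) i j :
  (A *m q_ R a b x) i j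
  = 'i * (spin R (enum_val j) x)%:C * A i (enum_rank (flip_left x (enum_val j))).
Proof. exact: mulmx_basis. Qed.

Lemma p_mulmx (R : realType) (a b x : int) (A : op R a b) i j :
  (p_ R a b x *m A) i j
  = (spin R (flip_left x (enum_val i)) (x + 1))%:C
      * A (enum_rank (flip_left x (enum_val i))) j.
Proof. exact/basis_mulmx/flip_leftK. Qed.

Lemma q_mulmx (R : realType) (a b x : int) (A : op R a b) i j :
  (q_ R a b x *m A) i j
  = 'i * (spin R (flip_left x (enum_val i)) x)%:C
      * A (enum_rank (flip_left x (enum_val i))) j.
Proof. exact/basis_mulmx/flip_leftK. Qed.

(** The flip changes both spins or neither on every bond except the one from [x] to [x + 1], whose
    term changes sign. *)
Lemma energy_flip (R : realType) (a b x : int) (s : config a b) : a <= x < b ->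
  \sum_(i < `|b - a|%N) spin R (flip_left x s) (a + i%:Z) * spin R (flip_left x s) (a + i%:Z + 1)
  = \sum_(i < `|b - a|%N) spin R s (a + i%:Z) * spin R s (a + i%:Z + 1)
    - 2%:R * (spin R s x * spin R s (x + 1)).
Proof.
move=> xab; have xm : (`|x - a| < `|b - a|)%N by lia.
have xE : a + (Ordinal xm)%:Z = x by rewrite /=; lia.
rewrite (bigD1 (Ordinal xm)) //= [in RHS](bigD1 (Ordinal xm)) //= xE.
rewrite !spin_flip; try lia.
rewrite lexx ifF; last by lia.
rewrite (eq_bigr (fun i : 'I_(`|b - a|%N) => spin R s (a + i%:Z) * spin R s (a + i%:Z + 1))).
  by ring.
move=> i /negP ix; have /eqP : (i : nat) <> `|x - a|%N by move=> e; apply/ix/eqP/val_inj.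
have := ltn_ord i => im ne; rewrite !spin_flip; try lia.
by case: ifP => h1; case: ifP => h2; try lia; ring.
Qed.

Lemma spin_pm (R : realType) (a b x : int) (s : config a b) :
  spin R s x = 1 \/ spin R s x = -1.
Proof. by rewrite /spin; case: (s _); [right | left]. Qed.

Lemma expR_complexN (R : realType) (beta : R) :
  (expR (- beta))%:C = (expR beta)%:C^-1.
Proof. by rewrite expRN fmorphV. Qed.

Lemma expR_complex_neq0 (R : realType) (beta : R) : (expR beta)%:C != 0 :> R[i].
Proof. by rewrite fmorph_eq0 expR_eq0. Qed.

Lemma spin_sqr (R : realType) (a b x : int) (s : config a b) :
  (spin R s x)%:C ^+ 2 = 1 :> R[i].
Proof. by rewrite -rmorphXn /spin sqrr_sign. Qed.

(** A product of two spins is a sign, and exp (± beta) = cosh beta ± sinh beta. Weights thus become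
    polynomial in the spins, within reach of [ring] and [field]. *)
Lemma expR_spinM (R : realType) (a b x y : int) (beta : R) (s t : config a b) :
  let h := (expR beta)%:C in
  (expR (beta * (spin R s x * spin R t y)))%:C
  = cosh_of h + (spin R s x)%:C * (spin R t y)%:C * sinh_of h.
Proof.
move: (expR_complex_neq0 beta) (expR_complexN beta); cbv zeta.
case: (spin_pm R x s) => ->; case: (spin_pm R y t) => ->;
  rewrite ?(mulrNN, mulr1, mulrN1) /cosh_of /sinh_of;
  move: (expR (- beta))%:C (expR beta)%:C => hN h h0 hNE;
  by rewrite ?hNE ?rmorphN1 ?rmorph1; field; rewrite h0.
Qed.

Lemma mulmx_comb (K : comNzRingType) (m : nat) (A B C : 'M[K]_m) (u v : K) i j :
  (A *m (u *: B + v *: C)) i j = u * (A *m B) i j + v * (A *m C) i j.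
Proof. by rewrite mulmxDr -!scalemxAr !mxE. Qed.

(** Both entries vanish unless the two configurations are flips of each other; otherwise
    [energy_flip] makes their quotient the exponential of one bond. Isolating the common factor [k]
    reduces the conjugation to an identity between signs. *)
Lemma Vh_half_entry (R : realType) (a b x : int) (beta : R) (i j : 'I_#|config a b|) :
  a <= x < b ->
  let t := enum_val j in let h := (expR beta)%:C in
  exists k : R[i],
    Vh_half a b beta (enum_rank (flip_left x (enum_val i))) j
      = k * (cosh_of h + (spin R t x)%:C * (spin R t (x + 1))%:C * sinh_of h) /\
    Vh_half a b beta i (enum_rank (flip_left x t)) = k /\
    (k != 0 -> enum_val i = flip_left x t).
Proof.
move=> xab t h; set s := enum_val i.
exists (Vh_half a b beta i (enum_rank (flip_left x t))).
rewrite -expR_spinM !mxE !enum_rankK -/s -/t.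
have [->|ne] := eqVneq s (flip_left x t).
  rewrite flip_leftK eqxx /= energy_flip // -rmorphM -expRD; split=> //.
  by congr (expR _)%:C; field.
rewrite ifF /= ?mul0r ?eqxx //.
by apply: contraNF ne => /eqP <-; rewrite flip_leftK.
Qed.

Lemma Vh_half_flip (R : realType) (a b x : int) (beta : R) : a <= x < b ->
  let h := (expR beta)%:C in
  p_ R a b x *m Vh_half a b beta = Vh_half a b beta *m
    (cosh_of h *: p_ R a b x + (- 'i * sinh_of h) *: q_ R a b x) /\
  q_ R a b x *m Vh_half a b beta = Vh_half a b beta *m
    (cosh_of h *: q_ R a b x + ('i * sinh_of h) *: p_ R a b x).
Proof.
have i2 : 'i ^+ 2 = -1 :> R[i] by exact: sqr_i.
move=> xab h.
split; apply/matrixP => i j; rewrite mulmx_comb mulmx_p mulmx_q ?p_mulmx ?q_mulmx;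
  have [k [-> [-> ks]]] := Vh_half_entry beta i j xab;
  (have [->|/ks->] := eqVneq k 0; first by rewrite mul0r !mulr0 addr0);
  rewrite flip_leftK -/h;
  have z2 := spin_sqr R x (enum_val j); have z'2 := spin_sqr R (x + 1) (enum_val j);
  by ring: i2 z2 z'2.
Qed.

(** Each one-site weight depends only on the product of its two spins, so a flip can be moved from
    one argument to the other. *)
Lemma Vv_flip_left (R : realType) (a b x : int) (beta : R) (i j : 'I_#|config a b|) : a < b ->
  Vv a b beta (enum_rank (flip_left x (enum_val i))) j
  = Vv a b beta i (enum_rank (flip_left x (enum_val j))).
Proof.
move=> ab; rewrite Vv_kernel // !mxE !enum_rankK; congr _%:C.
apply: eq_bigr => k _; rewrite !ffunE /Vv_weight.
rewrite !signr_addb mulrAC mulrA.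
by case: (enum_val i k); case: (enum_val j k); case: (_ <= x)%R.
Qed.

(** The two flips differ only at the site [x + 1], which is interior and so free of the end
    constraint; [k] collects the weights of all other sites. *)
Lemma Vv_flip_step (R : realType) (a b x : int) (beta : R) (i j : 'I_#|config a b|) :
  a <= x -> x + 1 < b ->
  let z := (spin R (enum_val i) (x + 1))%:C in
  let z' := (spin R (enum_val j) (x + 1))%:C in
  let h := (expR beta)%:C in
  exists k : R[i],
    Vv a b beta i (enum_rank (flip_left x (enum_val j)))
      = k * (cosh_of h + z * z' * sinh_of h) /\
    Vv a b beta i (enum_rank (flip_left (x + 1) (enum_val j)))
      = k * (cosh_of h - z * z' * sinh_of h).
Proof.
move=> ax xb z z' h; have ab : a < b by lia.
have xm : (`|(x + 1 - a : int)| < `|(b - a : int)|.+1)%N by lia.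
pose o := Ordinal xm; have oE : a + o%:Z = x + 1 by rewrite /o /=; lia.
have oin : (o \in [:: ord0; ord_max]) = false.
  by rewrite !inE; apply/negP => /orP[] /eqP /(congr1 val) /=; lia.
have xF : (x + 1 <= x) = false by lia.
exists (\prod_(k < _ | k != o) Vv_weight beta k (enum_val i k)
          (flip_left x (enum_val j) k))%:C.
rewrite -mulNr -mulrN -rmorphN -mulN1r.
have -> : -1 * spin R (enum_val j) (x + 1) = spin R (flip_left (x + 1) (enum_val j)) (x + 1).
  by rewrite spin_flip ?lexx //; lia.
have -> : z' = (spin R (flip_left x (enum_val j)) (x + 1))%:C.
  by rewrite spin_flip ?xF ?mul1r //; lia.
rewrite -!expR_spinM Vv_kernel // !mxE !enum_rankK -!rmorphM.
rewrite -oE !spinE; split; congr _%:C; rewrite (bigD1 o) //= mulrC; congr (_ * _);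
  try by rewrite /Vv_weight oin.
apply: eq_bigr => k ko; rewrite !ffunE; congr (Vv_weight _ _ _ (_ (+) _)).
have ko' : (k : nat) <> `|(x + 1 - a : int)|%N.
  by move=> e; case/eqP: ko; apply/val_inj.
by move: (nat_of_ord k) ko' => m ko'; apply/idP/idP; lia.
Qed.

Lemma expR_complex4_neq1 (R : realType) (beta : R) : 0 < beta ->
  (expR beta)%:C ^+ 4 - 1 != 0 :> R[i].
Proof.
move=> beta0.
have : expR beta ^+ 4 - 1 != 0 by rewrite subr_eq0 gt_eqF // exprn_egt1 ?expR_gt1.
by rewrite -(fmorph_eq0 (real_complex R)) rmorphB rmorphXn rmorph1.
Qed.

(** [p_] at [x] and [q_] at [x + 1] read the same spin, at [x + 1], and their flips differ only
    there. By [Vv_flip_step] the claim is a rational identity in [h], modulo i^2 = -1 and the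
    squares of spins being 1. *)
Lemma Vv_flip (R : realType) (a b x : int) (beta : R) : 0 < beta ->
  a <= x -> x + 1 < b ->
  let h := (expR beta)%:C in
  p_ R a b x *m Vv a b beta = Vv a b beta *m
    (coth2_of h *: p_ R a b x + ('i * csch2_of h) *: q_ R a b (x + 1)) /\
  q_ R a b (x + 1) *m Vv a b beta = Vv a b beta *m
    (coth2_of h *: q_ R a b (x + 1) + (- 'i * csch2_of h) *: p_ R a b x).
Proof.
have i2 : 'i ^+ 2 = -1 :> R[i] by exact: sqr_i.
move=> beta0 ax xb; cbv zeta.
have ab : a < b by lia.
have xab : a <= x + 1 <= b by lia.
have xF : (x + 1 <= x) = false by lia.
have h0 := expR_complex_neq0 beta; have := expR_complex4_neq1 beta0.
rewrite (exprM _ 2 2) expr2 => h4.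
split; apply/matrixP => i j; rewrite mulmx_comb mulmx_p mulmx_q ?p_mulmx ?q_mulmx Vv_flip_left //;
  have [k [-> ->]] := Vv_flip_step beta i j ax xb;
  rewrite spin_flip // ?xF ?lexx.
all: have z2 := spin_sqr R (x + 1) (enum_val i).
all: have z'2 := spin_sqr R (x + 1) (enum_val j).
all: move: (expR beta)%:C h0 h4 => h h0 h4; rewrite rmorphM ?rmorphN1 ?rmorph1.
all: rewrite /coth2_of /csch2_of /cosh_of /sinh_of; field: i2 z2 z'2; by rewrite h0 h4.
Qed.

(** The spin read here is the one at [b], which the flip leaves alone and V^v conserves. *)
Lemma Vv_flip_last (R : realType) (a b : int) (beta : R) : a < b ->
  p_ R a b (b - 1) *m Vv a b beta = Vv a b beta *m p_ R a b (b - 1).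
Proof.
move=> ab; apply/matrixP => i j.
rewrite p_mulmx mulmx_p.
rewrite Vv_flip_left // spin_flip; last by lia.
rewrite ifF ?mul1r; last by lia.
rewrite mxE enum_rankK subrK; case: ifP => [/andP[_ /eqP->]|]; last by rewrite !mulr0.
by rewrite spin_flip; [rewrite ifF ?mul1r //; lia | lia].
Qed.

(** The spin read here is the one at [a], the only spin flipped; V^v conserves it, so the signs on
    the two sides match. *)
Lemma Vv_flip_first (R : realType) (a b : int) (beta : R) : a < b ->
  q_ R a b a *m Vv a b beta = Vv a b beta *m q_ R a b a.
Proof.
move=> ab; apply/matrixP => i j.
rewrite q_mulmx mulmx_q.
rewrite Vv_flip_left // spin_flip; last by lia.
rewrite lexx.
rewrite mxE enum_rankK; case: ifP => [/andP[/eqP-> _]|]; last by rewrite !mulr0.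
by rewrite spin_flip; [rewrite lexx !mulN1r opprK | lia].
Qed.

(** * The local relations as identities in the coefficients *)

(** Here [l], [I], [h], [r] stand for lambda, i, e^beta, sqrt 2, and [A], [B], [A'], [B'] for P_k,
    Q_k, Q_{k+1}, P_{k-1}. The relations are linear in these matrices; with [I] written as [l ^+ 2],
    each coefficient is a rational identity in [l], [h] and [r] modulo [l ^+ 4 = -1]. *)
Lemma face_identity (K : fieldType) (m : nat) (l I h r : K) (A B A' B' : 'M[K]_m) :
  l ^+ 4 = -1 -> l ^+ 2 = I ->
  [/\ 2%:R != 0 :> K, r != 0, h != 0 & h ^+ 4 - 1 != 0] ->
  1 + I * h ^+ 2 != 0 -> 1 - I * h ^+ 2 != 0 ->
  let C := cosh_of h in let S := sinh_of h in
  let c := coth2_of h in let s := csch2_of h in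
  let v := l ^- 3 * ((h ^- 2 + I) / (h ^- 2 - I)) in
  let u := l * s / r in
  let pS := C *: A + (I * S) *: B in
  let qS := C *: B + (- I * S) *: A in
  let A1 := c *: A + (I * s) *: A' in
  let B1 := c *: B + (- I * s) *: B' in
  let pN := C *: A1 + (- I * S) *: B1 in
  let qN := C *: B1 + (I * S) *: A1 in
  let E := u *: ((C + I * S) *: A + (I * (C - I * S)) *: A') in
  let Eb := u *: ((C - I * S) *: A + (I * (C + I * S)) *: A') in
  let W := u *: ((C + I * S) *: B' + (I * (C - I * S)) *: B) in
  let Wb := u *: ((C - I * S) *: B' + (I * (C + I * S)) *: B) in
  let north := (I / r) *: (pN + qN) in
  let northb := (1 / r) *: (pN - qN) in
  let south := (I / r) *: (pS + qS) in
  let southb := (1 / r) *: (pS - qS) in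
  [/\ north + (v^-1 * l) *: northb = v^-1 *: E + l *: Eb,
      north + (v * l^-1) *: northb = v *: W + l^-1 *: Wb,
      south + (v * l ^+ 3) *: southb = v *: E + l ^+ 3 *: Eb
    & south + (v^-1 * l ^- 3) *: southb = v^-1 *: W + l ^- 3 *: Wb].
Proof.
move=> l4 <- [two0 r0 h0 h4] hp hm; rewrite /cosh_of /sinh_of /coth2_of /csch2_of /=.
have l0 : l != 0 by apply/eqP => l0; move/eqP: l4; rewrite l0 expr0n eq_sym oppr_eq0 oner_eq0.
(* The nonvanishing facts are restated in the shape of the side conditions that [field] leaves. *)
have h4' : (h * h) ^+ 2 - 1 != 0 by rewrite -expr2 -exprM.
have hp' : 1 + (l * h) ^+ 2 != 0 by rewrite exprMn.
have hm' : 1 + - l ^+ 2 * h ^+ 2 != 0 by rewrite mulNr.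
by split; apply/matrixP => i j; rewrite !mxE; field: l4;
  rewrite two0 r0 h0 h4' l0 ?hp' ?hm'.
Qed.

(** The sum equals [u * (1 + I)] times h A + I h^-1 A', which vanishes exactly for the stated
    multiple; this dictates the left ghost. *)
Lemma left_boundary_identity (K : fieldType) (m : nat) (I h u : K) (A A' : 'M[K]_m) :
  I ^+ 2 = -1 -> 2%:R != 0 :> K -> h != 0 ->
  let C := cosh_of h in let S := sinh_of h in A = (- I * h ^- 2) *: A' ->
  u *: ((C + I * S) *: A + (I * (C - I * S)) *: A')
    + I *: (u *: ((C - I * S) *: A + (I * (C + I * S)) *: A')) = 0.
Proof.
move=> I2 two0 h0 /= ->; rewrite /cosh_of /sinh_of.
by apply/matrixP => i j; rewrite !mxE; field: I2; rewrite two0 h0.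
Qed.

(** The difference equals [u * (1 - I)] times h^-1 A + I h A', which dictates the right ghost. *)
Lemma right_boundary_identity (K : fieldType) (m : nat) (I h u : K) (A A' : 'M[K]_m) :
  I ^+ 2 = -1 -> 2%:R != 0 :> K -> h != 0 ->
  let C := cosh_of h in let S := sinh_of h in A' = (I * h ^- 2) *: A ->
  u *: ((C + I * S) *: A + (I * (C - I * S)) *: A')
    - I *: (u *: ((C - I * S) *: A + (I * (C + I * S)) *: A')) = 0.
Proof.
move=> I2 two0 h0 /= ->; rewrite /cosh_of /sinh_of.
by apply/matrixP => i j; rewrite !mxE; field: I2; rewrite two0 h0.
Qed.

(** * Conjugation by the transfer matrix, with ghosts at the ends *)

Definition conj_by (K : fieldType) (m : nat) (M A : 'M[K]_m) := invmx M *m A *m M.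

Lemma conj_byE (K : fieldType) (m : nat) (M A B : 'M[K]_m) :
  M \in unitmx -> A *m M = M *m B -> conj_by M A = B.
Proof. by move=> Mu AM; rewrite /conj_by -mulmxA AM mulKmx. Qed.

Lemma conj_by_comb (K : fieldType) (m : nat) (M A B : 'M[K]_m) (u v : K) :
  conj_by M (u *: A + v *: B) = u *: conj_by M A + v *: conj_by M B.
Proof. by rewrite /conj_by mulmxDr mulmxDl -!scalemxAr -!scalemxAl. Qed.

Lemma conj_byZ (K : fieldType) (m : nat) (M A : 'M[K]_m) (u : K) :
  conj_by M (u *: A) = u *: conj_by M A.
Proof. by rewrite /conj_by -!scalemxAr -!scalemxAl. Qed.

Lemma conj_byM (K : fieldType) (m : nat) (M M' A : 'M[K]_m) :
  M \in unitmx -> M' \in unitmx ->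
  conj_by (M *m M') A = conj_by M' (conj_by M A).
Proof.
move=> Mu Mu'; have MMu : M *m M' \in unitmx by rewrite unitmx_mul Mu.
apply: conj_byE => //; rewrite /conj_by.
by rewrite !mulmxA mulmxK // mulmxV // mul1mx.
Qed.

(** The extra conjugation is placed innermost, so that the factors of V act directly on the
    generators. *)
Lemma evolveS (R : realType) (a b : int) (beta : R) (y : nat) (A : op R a b) :
  evolve beta y.+1 A = evolve beta y (conj_by (V a b beta) A).
Proof. by rewrite /evolve /conj_by exprSr exprS -!mulmxE !mulmxA. Qed.

Lemma evolve_comb (R : realType) (a b : int) (beta : R) (y : nat) (A B : op R a b) u v :
  evolve beta y (u *: A + v *: B) = u *: evolve beta y A + v *: evolve beta y B.
Proof. by rewrite /evolve mulmxDr mulmxDl -!scalemxAr -!scalemxAl. Qed.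

(* The value outside [a, b) is the ghost for which the bulk formula [Vv_flip] also
   holds at the ends: p_ext is meant for x >= a - 1, and q_ext for x <= b. *)
Definition p_ext (R : realType) (a b : int) (beta : R) (x : int) : op R a b :=
  if x < a then (- 'i * (expR beta)%:C ^- 2) *: q_ R a b a else p_ R a b x.

Definition q_ext (R : realType) (a b : int) (beta : R) (x : int) : op R a b :=
  if x < b then q_ R a b x else ('i * (expR beta)%:C ^- 2) *: p_ R a b (b - 1).

Lemma Vv_conj (R : realType) (a b x : int) (beta : R) : 0 < beta -> a <= x < b ->
  let h := (expR beta)%:C in
  conj_by (Vv a b beta) (p_ R a b x) =
    coth2_of h *: p_ R a b x + ('i * csch2_of h) *: q_ext a b beta (x + 1) /\
  conj_by (Vv a b beta) (q_ R a b x) =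
    coth2_of h *: q_ R a b x + (- 'i * csch2_of h) *: p_ext a b beta (x - 1).
Proof.
have i2 : 'i ^+ 2 = -1 :> R[i] by exact: sqr_i.
move=> beta0 /andP[ax xb] h.
have ab : a < b by exact: le_lt_trans xb.
have Vvu := Vv_unit ab beta0.
have h0 : h != 0 by exact: expR_complex_neq0.
have h4 : (h * h) ^+ 2 - 1 != 0 by rewrite -expr2 -exprM; exact: expR_complex4_neq1.
rewrite /p_ext /q_ext -/h.
split; apply: (conj_byE Vvu).
  case: ifP => xb1; first exact: (proj1 (Vv_flip beta0 ax xb1)).
  have -> : x = b - 1 by lia.
  (* With the ghost inserted, the coefficient of the last [p_] is coth (2 beta) - e^(-2 beta) / sinh
     (2 beta) = 1, in agreement with V^v fixing it. The left end below is the mirror image. *)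
  rewrite scalerA -scalerDl -scalemxAr Vv_flip_last // -[LHS]scale1r; congr (_ *: _).
  move: h h0 h4 => h h0 h4; rewrite /coth2_of /csch2_of.
  by field: i2; rewrite h0.
case: ifP => xa1; last first.
  have ax1 : a <= x - 1 by lia.
  have xb1 : x - 1 + 1 < b by lia.
  have [_ +] := Vv_flip beta0 ax1 xb1.
  by rewrite subrK => ->.
have -> : x = a by lia.
rewrite scalerA -scalerDl -scalemxAr Vv_flip_first // -[LHS]scale1r; congr (_ *: _).
move: h h0 h4 => h h0 h4; rewrite /coth2_of /csch2_of.
by field: i2; rewrite h0.
Qed.

Lemma Vh_half_conj (R : realType) (a b x : int) (beta : R) : a <= x < b ->
  let h := (expR beta)%:C in
  conj_by (Vh_half a b beta) (p_ R a b x) =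
    cosh_of h *: p_ R a b x + (- 'i * sinh_of h) *: q_ R a b x /\
  conj_by (Vh_half a b beta) (q_ R a b x) =
    cosh_of h *: q_ R a b x + ('i * sinh_of h) *: p_ R a b x.
Proof.
move=> xab h; case: (Vh_half_flip beta xab) => pE qE.
by split; [apply: conj_byE pE | apply: conj_byE qE]; exact: Vh_half_unit.
Qed.

(** The P_k of the idea, ghost included, transported to row [y]. *)
Definition p_edge (R : realType) (a b : int) (beta : R) (y : nat) (x : int) : op R a b :=
  evolve beta y (conj_by (Vh_half a b beta) (p_ext a b beta x)).

Definition q_edge (R : realType) (a b : int) (beta : R) (y : nat) (x : int) : op R a b :=
  evolve beta y (conj_by (Vh_half a b beta) (q_ext a b beta x)).

(** Conjugation by (V^h)^{1/2} acts on the span of p_k and q_k as a hyperbolic rotation; the inverse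
    reverses the sign of sinh, by cosh^2 - sinh^2 = 1. *)
Lemma boost_inverse (K : fieldType) (m : nat) (I h : K) (p q : 'M[K]_m) :
  I ^+ 2 = -1 -> 2%:R != 0 :> K -> h != 0 ->
  let C := cosh_of h in let S := sinh_of h in
  p = C *: (C *: p + (- I * S) *: q) + (I * S) *: (C *: q + (I * S) *: p) /\
  q = C *: (C *: q + (I * S) *: p) + (- I * S) *: (C *: p + (- I * S) *: q).
Proof.
move=> I2 two0 h0 /=; rewrite /cosh_of /sinh_of.
by split; apply/matrixP => i j; rewrite !mxE; field: I2; rewrite two0 h0.
Qed.

Lemma evolve_south (R : realType) (a b x : int) (y : nat) (beta : R) : a <= x < b ->
  let h := (expR beta)%:C in
  let A := p_edge a b beta y x in let B := q_edge a b beta y x in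
  evolve beta y (p_ R a b x) = cosh_of h *: A + ('i * sinh_of h) *: B /\
  evolve beta y (q_ R a b x) = cosh_of h *: B + (- 'i * sinh_of h) *: A.
Proof.
move=> xab; cbv zeta; rewrite /p_edge /q_edge.
have [-> ->] : p_ext a b beta x = p_ R a b x /\ q_ext a b beta x = q_ R a b x.
  by rewrite /p_ext /q_ext; have [-> ->] : (x < a) = false /\ (x < b) by lia.
have two0 : 2%:R != 0 :> R[i] by rewrite pnatr_eq0.
move: (expR_complex_neq0 beta) (Vh_half_conj beta xab).
cbv zeta; move: (expR beta)%:C (p_ R a b x) (q_ R a b x) => h p q h0 [pH qH].
have [pE qE] := boost_inverse p q (sqr_i R) two0 h0.
by split; rewrite -evolve_comb pH qH -?pE -?qE.
Qed.

(** The first factor (V^h)^{1/2} mixes p_k with q_k, then V^v brings in the neighbours or ghosts,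
    and the last (V^h)^{1/2} is absorbed into [p_edge] and [q_edge]. *)
Lemma evolve_north (R : realType) (a b x : int) (y : nat) (beta : R) : 0 < beta ->
  a <= x < b ->
  let h := (expR beta)%:C in
  let A := coth2_of h *: p_edge a b beta y x
           + ('i * csch2_of h) *: q_edge a b beta y (x + 1) in
  let B := coth2_of h *: q_edge a b beta y x
           + (- 'i * csch2_of h) *: p_edge a b beta y (x - 1) in
  evolve beta y.+1 (p_ R a b x) = cosh_of h *: A + (- 'i * sinh_of h) *: B /\
  evolve beta y.+1 (q_ R a b x) = cosh_of h *: B + ('i * sinh_of h) *: A.
Proof.
move=> beta0 xab; cbv zeta; have ab : a < b by lia.
have Hu := Vh_half_unit a b beta; have Wu := Vv_unit ab beta0.
have [px qx] : p_ext a b beta x = p_ R a b x /\ q_ext a b beta x = q_ R a b x.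
  by rewrite /p_ext /q_ext; have [-> ->] : (x < a) = false /\ (x < b) by lia.
rewrite /p_edge /q_edge px qx !evolveS !conj_byM ?unitmx_mul ?Hu //.
move: (Vh_half_conj beta xab) (Vv_conj beta0 xab).
cbv zeta; move: (expR beta)%:C (p_ R a b x) (q_ R a b x) => h p q.
move: (p_ext a b beta (x - 1)) (q_ext a b beta (x + 1)) => p' q' [pH qH] [pW qW].
rewrite (congr1 (conj_by (Vv a b beta)) pH) (congr1 (conj_by (Vv a b beta)) qH).
rewrite !conj_by_comb pW qW !conj_by_comb.
move: (conj_by _ p) (conj_by _ q) (conj_by _ p') (conj_by _ q') => A B A' B'.
by rewrite !evolve_comb.
Qed.

(** * Fermions on the edges *)

(** Here [x] is a site, so [x - 1] and [x] encode the half-integers on its two sides. With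
    [psibar_vert], this solves the relations through E on the face to the left and those through W
    on the face to the right, wherever these faces exist. *)
Definition psi_vert (R : realType) (a b : int) (beta : R) (y : nat) (x : int) : op R a b :=
  let h := (expR beta)%:C in
  (lambda R * csch2_of h / (Num.sqrt 2%:R)%:C) *:
    ((cosh_of h + 'i * sinh_of h) *: p_edge a b beta y (x - 1)
     + ('i * (cosh_of h - 'i * sinh_of h)) *: q_edge a b beta y x).

Definition psibar_vert (R : realType) (a b : int) (beta : R) (y : nat) (x : int) : op R a b :=
  let h := (expR beta)%:C in
  (lambda R * csch2_of h / (Num.sqrt 2%:R)%:C) *:
    ((cosh_of h - 'i * sinh_of h) *: p_edge a b beta y (x - 1)
     + ('i * (cosh_of h + 'i * sinh_of h)) *: q_edge a b beta y x).

(** Horizontal midpoints have integer ordinate and vertical ones half-integer ordinate, so [y] alone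
    tells them apart; floors then recover the integer indices. *)
Definition edge_fun (R : realType) (T : Type) (hor vert : nat -> int -> T) (z : R[i]) : T :=
  let: x +i* y := z in
  (if y \is a Num.int then hor else vert) `|Num.floor y|%N (Num.floor x).

Lemma floor_half (R : realType) (x : int) : Num.floor (x%:~R + 2%:R^-1 : R) = x.
Proof. by apply: floor_def; rewrite intrD; apply/andP; split; lra. Qed.

Lemma int_half (R : realType) (x : int) : (x%:~R + 2%:R^-1 : R) \is a Num.int = false.
Proof.
apply/negbTE/negP; rewrite intrEfloor floor_half => /eqP /(congr1 (fun t => t - x%:~R)).
by rewrite subrr addrAC subrr add0r => /esym/eqP; rewrite invr_eq0 pnatr_eq0.
Qed.

Lemma edge_fun_hor (R : realType) (T : Type) (hor vert : nat -> int -> T) (x : int) (y : nat) :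
  edge_fun hor vert ((x%:~R + 2%:R^-1) +i* y%:R : R[i]) = hor y x.
Proof. by rewrite /edge_fun [y%:R]pmulrn floor_half intr_int intrKfloor absz_nat. Qed.

Lemma edge_fun_vert (R : realType) (T : Type) (hor vert : nat -> int -> T) (x : int) (y : nat) :
  edge_fun hor vert (x%:~R +i* (y%:Z%:~R + 2%:R^-1) : R[i]) = vert y x.
Proof. by rewrite /edge_fun int_half floor_half intrKfloor absz_nat. Qed.

Lemma nuE (R : realType) (beta : R) : let h := (expR beta)%:C in
  nu beta = lambda R ^- 3 * ((h ^- 2 + 'i) / (h ^- 2 - 'i)).
Proof.
by rewrite /nu expRN expRM_natl fmorphV rmorphXn.
Qed.

Lemma lambda4 (R : realType) : lambda R ^+ 4 = -1.
Proof. by rewrite (exprM _ 2 2) lambda_sq sqr_i. Qed.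

Lemma one_add_imag_neq0 (R : realType) (x : R) : 1 + 'i * x%:C != 0 :> R[i].
Proof.
apply/eqP => /(congr1 (@complex.Re R)) /= /eqP.
by rewrite mul0r mulr0 subrr addr0 oner_eq0.
Qed.

Lemma complex_half (R : realType) : 2%:R^-1 = (2%:R^-1)%:C :> R[i].
Proof. by rewrite fmorphV rmorph_nat. Qed.

Definition face_center (R : realType) (x : int) (y : nat) : R[i] :=
  (x%:~R + 2%:R^-1) +i* (y%:Z%:~R + 2%:R^-1).

Lemma face_center_edges (R : realType) (x : int) (y : nat) :
  let c := face_center R x y in
  [/\ c + 'i / 2%:R = (x%:~R + 2%:R^-1) +i* y.+1%:R,
      c - 'i / 2%:R = (x%:~R + 2%:R^-1) +i* y%:R,
      c + 2%:R^-1 = (x + 1)%:~R +i* (y%:Z%:~R + 2%:R^-1)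
    & c - 2%:R^-1 = x%:~R +i* (y%:Z%:~R + 2%:R^-1)].
Proof.
have half2 : 2%:R^-1 + 2%:R^-1 = 1 :> R by field.
rewrite /face_center complex_half -!pmulrn /=.
split; apply/eqP; rewrite eq_complex /=; apply/andP; split; apply/eqP;
  rewrite ?intrD -?(natr1 _ y); lra.
Qed.

Lemma face_centersP (R : realType) (a b : int) (N : nat) (c : R[i]) :
  face_centers a b N c <->
  exists x y, [/\ a <= x < b, (y < N)%N & c = face_center R x y].
Proof.
split=> [[_ [x /= xab <-]] [_ [t /= tN <-]] <-|[x [y [xab yN ->]]]].
  exists x, `|t|%N; split; [exact: xab | lia | ].
  by rewrite /face_center gez0_abs //; lia.
exists (x%:~R + 2%:R^-1); first by exists x.
by exists (y%:Z%:~R + 2%:R^-1) => //; exists y%:Z => //=; lia.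
Qed.

Lemma vertical_edgesP (R : realType) (a b : int) (N : nat) (z : R[i]) : a < b ->
  vertical_edges a b N z ->
  exists x y, [/\ a <= x < b, (y < N)%N &
    z = face_center R x y + 2%:R^-1 \/ z = face_center R x y - 2%:R^-1].
Proof.
move=> ab [_ [x /= xab <-]] [_ [t /= tN <-]] <-; have yN : (`|t| < N)%N by lia.
have tE : t = `|t|%N by lia.
(* An edge on the left boundary is the W edge of the first face of its row; every other edge is the
   E edge of the face on its left. *)
have [xa|xa] := eqVneq x a.
  exists x, `|t|%N; split; [lia | exact: yN | ].
  right; have [_ _ _ ->] := face_center_edges R x `|t|%N; rewrite -tE //.
exists (x - 1), `|t|%N; split; [lia | exact: yN | ].
left; have [_ _ -> _] := face_center_edges R (x - 1) `|t|%N; rewrite subrK -tE //.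
Qed.

Lemma evolve_psi (R : realType) (a b x : int) (y : nat) (beta : R) :
  let p := evolve beta y (p_ R a b x) in let q := evolve beta y (q_ R a b x) in
  evolve beta y (psi_ R a b x) = ('i / (Num.sqrt 2%:R)%:C) *: (p + q) /\
  evolve beta y (psibar_ R a b x) = (1 / (Num.sqrt 2%:R)%:C) *: (p - q).
Proof.
rewrite /psi_ /psibar_; move: (p_ R a b x) (q_ R a b x) => p q /=.
split; first by rewrite !scalerDr evolve_comb.
by rewrite !scalerBr -!scaleNr evolve_comb.
Qed.

(** * Uniqueness on the vertical edges *)

Lemma linear_system_unique (K : fieldType) (m : nat) (u v u' v' : K) (X Y X' Y' : 'M[K]_m) :
  u * v' - v * u' != 0 ->
  u *: X + v *: Y = u *: X' + v *: Y' -> u' *: X + v' *: Y = u' *: X' + v' *: Y' ->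
  X = X' /\ Y = Y'.
Proof.
move=> d0 e1 e2; split; apply/matrixP => i j;
  move/matrixP/(_ i j): e1; move/matrixP/(_ i j): e2; rewrite !mxE => e2 e1;
  (* Cramer's rule: the determinant times each unknown is a combination of the two equations. *)
  apply/(mulfI d0).
- transitivity (v' * (u * X i j + v * Y i j) - v * (u' * X i j + v' * Y i j)); first by ring.
  by rewrite e1 e2; ring.
- transitivity (u * (u' * X i j + v' * Y i j) - u' * (u * X i j + v * Y i j)); first by ring.
  by rewrite e1 e2; ring.
Qed.

Lemma face_determinants (K : fieldType) (l I h : K) :
  l ^+ 4 = -1 -> l ^+ 2 = I -> 2%:R != 0 :> K -> h != 0 ->
  1 + I * h ^+ 2 != 0 -> 1 - I * h ^+ 2 != 0 ->
  let v := l ^- 3 * ((h ^- 2 + I) / (h ^- 2 - I)) in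
  v^-1 * l ^+ 3 - l * v != 0 /\ v * l ^- 3 - l^-1 * v^-1 != 0.
Proof.
move=> l4 <- two0 h0 hp hm v.
have l0 : l != 0 by apply/eqP => l0; move/eqP: l4; rewrite l0 expr0n eq_sym oppr_eq0 oner_eq0.
(* For h = e^beta this common value of both determinants is -2 / cosh (2 beta). *)
pose d := - (2%:R * h) ^+ 2 / ((1 + l ^+ 2 * h ^+ 2) * (1 - l ^+ 2 * h ^+ 2)).
have d0 : d != 0.
  by rewrite mulf_neq0 ?invr_eq0 ?mulf_neq0 // oppr_eq0 expf_neq0 ?mulf_neq0.
have [-> ->] : v^-1 * l ^+ 3 - l * v = d /\ v * l ^- 3 - l^-1 * v^-1 = d; last by [].
by split; rewrite /v /d; field: l4; rewrite exprMn hm hp h0 l0.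
Qed.

Lemma complex2_neq0 (R : realType) : 2%:R != 0 :> R[i].
Proof. by rewrite pnatr_eq0. Qed.

Lemma face_coefs_neq0 (R : realType) (beta : R) : let h := (expR beta)%:C in
  [/\ 1 + 'i * h ^+ 2 != 0 :> R[i], 1 - 'i * h ^+ 2 != 0 :> R[i]
    & (Num.sqrt 2%:R)%:C != 0 :> R[i]].
Proof.
rewrite /= -rmorphXn -mulrN -rmorphN; split; try exact: one_add_imag_neq0.
by rewrite fmorph_eq0 sqrtr_eq0 -ltNge ltr0n.
Qed.

Lemma nu_determinants (R : realType) (beta : R) :
  let l := lambda R in let v := nu beta in
  v^-1 * l ^+ 3 - l * v != 0 /\ v * l ^- 3 - l^-1 * v^-1 != 0.
Proof.
have [hp hm _] := face_coefs_neq0 beta; rewrite /= nuE.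
exact: (face_determinants (lambda4 R) (lambda_sq R) (complex2_neq0 R)
  (expR_complex_neq0 beta) hp hm).
Qed.

Lemma vertical_values_unique (R : realType) (a b : int) (N : nat) (beta : R)
    (psi psibar psi' psibar' : R[i] -> op R a b) : a < b ->
  fermion_extension N beta psi psibar -> fermion_extension N beta psi' psibar' ->
  forall z, vertical_edges a b N z -> psi' z = psi z /\ psibar' z = psibar z.
Proof.
move=> ab [hor face _] [hor' face' _] z /(vertical_edgesP ab) [x [y [xab yN zE]]].
have cF : face_centers a b N (face_center R x y) by apply/face_centersP; exists x, y.
move: (face _ cF) (face' _ cF) (nu_determinants beta); rewrite /face_relations.
have [-> -> _ _] := face_center_edges R x y.
(* The left sides of the four relations involve only the horizontal edges in rows [y] and [y.+1], at
   most [N], where both extensions are prescribed. The first and third relations then determine E,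
   the second and fourth W. *)
have [-> ->] := hor x y.+1 xab yN; have [-> ->] := hor x y xab (ltnW yN).
have [-> ->] := hor' x y.+1 xab yN; have [-> ->] := hor' x y xab (ltnW yN).
cbv zeta; move: (nu beta) (lambda R) => v l [f1 f2 f3 f4] [g1 g2 g3 g4] [dE dW].
case: zE => ->.
  exact: (linear_system_unique dE (etrans (esym g1) f1) (etrans (esym g3) f3)).
exact: (linear_system_unique dW (etrans (esym g2) f2) (etrans (esym g4) f4)).
Qed.

(** * Existence of the extension *)

Lemma fermion_extensionI (R : realType) (a b : int) (N : nat) (beta : R)
    (psi psibar : R[i] -> op R a b) : a < b -> 0 < beta ->
  extends_horizontal N beta psi psibar ->
  (forall (x : int) (y : nat), let edge := x%:~R +i* (y%:Z%:~R + 2%:R^-1) in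
     psi edge = psi_vert a b beta y x /\ psibar edge = psibar_vert a b beta y x) ->
  fermion_extension N beta psi psibar.
Proof.
move=> ab beta0 hor vert; split; first exact: hor.
  move=> c /face_centersP[x [y [xab yN ->]]].
  have [hp hm r0] := face_coefs_neq0 beta.
  have := face_identity (p_edge a b beta y x) (q_edge a b beta y x)
    (q_edge a b beta y (x + 1)) (p_edge a b beta y (x - 1)) (lambda4 R) (lambda_sq R)
    (And4 (complex2_neq0 R) r0 (expR_complex_neq0 beta) (expR_complex4_neq1 beta0)) hp hm.
  rewrite /face_relations; have [-> -> -> ->] := face_center_edges R x y.
  have [-> ->] := vert x y; have [-> ->] := vert (x + 1) y.
  (* For the E edge, at site [x + 1], the index of [p_edge] simplifies to [x], so all four edges of
     the face use the same operators. *)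
  rewrite /psi_vert /psibar_vert addrK.
  have [-> ->] := hor x y.+1 xab yN; have [-> ->] := hor x y xab (ltnW yN).
  have [-> ->] := evolve_psi a b x y.+1 beta; have [-> ->] := evolve_psi a b x y beta.
  have [-> ->] := evolve_north y beta0 xab; have [-> ->] := evolve_south y beta xab.
  by rewrite nuE.
move=> _ [t /= tN <-].
have -> : t%:~R = `|t|%N%:Z%:~R :> R by congr _%:~R; lia.
have h0 := expR_complex_neq0 beta; have i2 := sqr_i R.
have [-> ->] := vert a `|t|%N; have [-> ->] := vert b `|t|%N.
split.
  apply: (left_boundary_identity _ i2 (complex2_neq0 R) h0).
  (* At the site [a] the index [a - 1] selects the ghost in [p_ext]; at [b] below, the index [b]
     selects the one in [q_ext]. *)
  have aF : a - 1 < a by lia.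
  rewrite /p_edge /q_edge /p_ext /q_ext aF ab conj_byZ.
  by rewrite /evolve -scalemxAr -scalemxAl.
apply: (right_boundary_identity _ i2 (complex2_neq0 R) h0).
have bF : (b - 1 < a) = false by lia.
rewrite /p_edge /q_edge /p_ext /q_ext bF ltxx conj_byZ.
by rewrite /evolve -scalemxAr -scalemxAl.
Qed.

Theorem theorem19 (R : realType) (a b : int) (N : nat) (beta : R)
    (hab : a < b) (hN : (1 <= N)%N) (hbeta : 0 < beta) :
  exists psi psibar : R[i] -> op R a b,
    fermion_extension N beta psi psibar /\
    (forall psi' psibar' : R[i] -> op R a b,
       fermion_extension N beta psi' psibar' ->
       forall z : R[i], vertical_edges a b N z ->
         psi' z = psi z /\ psibar' z = psibar z).
Proof.
pose psi : R[i] -> op R a b :=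
  edge_fun (fun y x => evolve beta y (psi_ R a b x)) (psi_vert a b beta).
pose psibar : R[i] -> op R a b :=
  edge_fun (fun y x => evolve beta y (psibar_ R a b x)) (psibar_vert a b beta).
have ext : fermion_extension N beta psi psibar.
  apply: fermion_extensionI => // [x y _ _|x y].
    by split; exact: edge_fun_hor.
  by split; exact: edge_fun_vert.
exists psi, psibar; split=> // psi' psibar'.
exact: vertical_values_unique.
Qed.
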